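(* There exist a dictionary $\mathcal{D}$ in the real Hilbert space $\ell_2$ and an element $f\in A_1(\mathcal{D})$ such that for all $m=1,2,\dots$ $$\sigma_m(f,\mathcal{D})=\frac{1}{\sqrt2}(m+1)^{-1/2}.$$
   Context: A dictionary in a real Banach space $X$ is a set $\mathcal{D}\subset X$ such that $\|g\|\le 1$ for every $g\in\mathcal{D}$, $g\in\mathcal{D}$ implies $-g\in\mathcal{D}$, and the closed linear span of $\mathcal{D}$ is $X$. $A_1^o(\mathcal{D}):=\{f\in X: f=\sum_{i=1}^\infty c_i g_i,\ g_i\in\mathcal{D},\ c_i\in\mathbb{R},\ \sum_{i=1}^\infty |c_i|\le 1\}$, and $A_1(\mathcal{D})$ is the closure of $A_1^o(\mathcal{D})$ in $X$. The error of best $m$-term approximation is $\sigma_m(f,\mathcal{D}):=\inf_{c_1,\dots,c_m\in\mathbb{R};\ g_1,\dots,g_m\in\mathcal{D}}\left\|f-\sum_{i=1}^m c_i g_i\right\|_X$. *)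

(* Defs.v *)
From HB Require Import structures.
From mathcomp Require Import all_boot all_order all_algebra.
From mathcomp Require Import all_classical all_reals all_analysis.

Set Implicit Arguments.
Unset Strict Implicit.
Unset Printing Implicit Defensive.
Import Order.TTheory GRing.Theory Num.Theory.
Import numFieldNormedType.Exports.
Local Open Scope classical_set_scope.
Local Open Scope ring_scope.

(* For the counting measure on the discrete space nat, every function is
   measurable and the only null set is empty, so this type of functions, not
   quotiented by a.e. equality, is the space of square-summable sequences;
   see ell2_ext, ell2_of and ell2_norm_cvg below. *)
Definition ell2 (R : realType) : Type :=
  LfunType (counting : {measure set nat -> \bar R}) (lee1n 2).

HB.instance Definition _ (R : realType) := GRing.Lmodule.on (ell2 R).

Section ell2_norm.
Variable R : realType.
Implicit Types x y : ell2 R.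

Definition ell2_norm x : R := fine ('N[counting]_2%:E[EFin \o x])%E.

Lemma ell2_ext x y : x =1 y -> x = y.
Proof. by move=> xy; apply/LfuneqP. Qed.

Lemma ell2_norm_ge0 x : 0 <= ell2_norm x.
Proof. by rewrite fine_ge0// Lnorm_ge0. Qed.

Lemma Lnorm_sqr (u : nat -> R) :
  (('N[counting]_2%:E[EFin \o u]) `^ 2 = \sum_(k <oo) (u k ^+ 2)%:E)%E.
Proof.
rewrite powR_Lnorm ?pnatr_eq0// ge0_integral_count//.
  by apply: eq_eseriesr => k _; rewrite /= powR_mulrn// real_normK ?num_real.
by move=> k; exact: poweR_ge0.
Qed.

Lemma nneseries_ell2_norm x :
  (\sum_(k <oo) (x k ^+ 2)%:E)%E = (ell2_norm x ^+ 2)%:E.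
Proof.
rewrite -Lnorm_sqr -(finite_norm_fine x) poweR_EFin powR_mulrn//.
exact: ell2_norm_ge0.
Qed.

Lemma ell2_norm_triangle x y : ell2_norm (x + y) <= ell2_norm x + ell2_norm y.
Proof. exact: ler_LnormD. Qed.

Lemma ell2_normZ (a : R) x : ell2_norm (a *: x) = `|a| * ell2_norm x.
Proof.
rewrite /ell2_norm -[RHS]/(fine `|a|%:E * _) -fineM ?LnormZ//.
by rewrite -finite_norm_fine.
Qed.

Lemma ell2_coord_le x k : `|x k| <= ell2_norm x.
Proof.
rewrite -(ler_pXn2r (n := 2))// ?nnegrE ?ell2_norm_ge0//.
rewrite real_normK ?num_real// -lee_fin -nneseries_ell2_norm.
have le0 i : xpredT i -> (0 <= (x i ^+ 2)%:E)%E by rewrite lee_fin sqr_ge0.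
apply: (le_trans _ (nneseries_lim_ge k.+1 _)) => [|i _]; last exact: le0.
by rewrite big_nat_recr//= leeDr// sume_ge0.
Qed.

Lemma ell2_norm_eq0 x : ell2_norm x = 0 -> x = 0.
Proof.
move=> x0; apply: ell2_ext => k; apply/eqP.
by rewrite -normr_le0 -x0 ell2_coord_le.
Qed.

End ell2_norm.

HB.instance Definition _ (R : realType) :=
  Lmodule_isNormed.Build R (ell2 R) (@ell2_norm_triangle R) (@ell2_normZ R)
    (@ell2_norm_eq0 R).

Section ell2_complete.
Variable R : realType.
Implicit Types x y : ell2 R.

Lemma ell2_norm_cvg x :
  series (fun k => x k ^+ 2) @ \oo --> `|x| ^+ 2.
Proof.
have h : (\sum_(k <oo) (x k ^+ 2)%:E)%E = (`|x| ^+ 2)%:E.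
  exact: nneseries_ell2_norm.
have : (fun n => \sum_(0 <= k < n) (x k ^+ 2)%:E)%E @ \oo --> (`|x| ^+ 2)%:E.
  rewrite -h; apply: is_cvg_nneseries => n _ _.
  by rewrite lee_fin sqr_ge0.
under eq_fun do rewrite sumEFin.
by move/fine_cvgP => [].
Qed.

Lemma ell2_of_subproof (u : nat -> R) (M : R) :
  (forall n, \sum_(0 <= k < n) u k ^+ 2 <= M) ->
  u \in Lfun (counting : {measure set nat -> \bar R}) 2%:E.
Proof.
move=> uM; apply/andP; split; rewrite inE//=.
rewrite /finite_norm.
apply: (@lty_poweRy _ _ 2); first by rewrite pnatr_eq0.
rewrite Lnorm_sqr; apply: (@le_lt_trans _ _ M%:E); last exact: ltry.
apply: lime_le => //.
  by apply: is_cvg_nneseries => n _ _; rewrite lee_fin sqr_ge0.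
by apply: nearW => n; rewrite sumEFin lee_fin.
Qed.

Lemma ell2_of (u : nat -> R) (M : R) :
  (forall n, \sum_(0 <= k < n) u k ^+ 2 <= M) ->
  exists x : ell2 R, (x : nat -> R) = u.
Proof.
move=> /ell2_of_subproof uL.
by exists (Lfun_Sub (lee1n 2) uL); exact: Lfun_valP.
Qed.

Lemma ell2_norm_le x (M : R) : 0 <= M ->
  (forall n, \sum_(0 <= k < n) x k ^+ 2 <= M ^+ 2) -> `|x| <= M.
Proof.
move=> M0 xM; rewrite -(ler_pXn2r (n := 2))// ?nnegrE//.
rewrite -(cvg_lim _ (@ell2_norm_cvg x))//.
apply: limr_le; first by apply/cvg_ex; exists (`|x| ^+ 2); exact: ell2_norm_cvg.
by apply: nearW => n; exact: xM.
Qed.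

Lemma ell2_norm_ge x n : \sum_(0 <= k < n) x k ^+ 2 <= `|x| ^+ 2.
Proof.
have hx := @ell2_norm_cvg x.
rewrite -(cvg_lim _ hx)//; apply: (nondecreasing_cvgn_le (u_ := series _)).
  by apply/nondecreasing_series => k _ _; rewrite sqr_ge0.
by apply/cvg_ex; exists (`|x| ^+ 2).
Qed.

Lemma ell2_complete (F : set_system (ell2 R)) :
  ProperFilter F -> cauchy F -> cvg F.
Proof.
move=> FF /cauchyP Fc.
have Fb (e : R) : 0 < e -> exists x0, \forall y \near F, `|x0 - y| < e.
  move=> /Fc[x0 Fx0]; exists x0; move: Fx0.
  by rewrite -ball_normE.
have coordP k : exists l : R, (fun x => x k) @ F --> l.
  suff : cvg ((fun x : ell2 R => x k : R) @ F) by move/cvg_ex.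
  apply: R_complete; apply: cauchy_exP => e /Fb[x0 Fx0].
  exists (x0 k); rewrite /nbhs/= /fmap/=.
  near=> y; rewrite /ball/= /ball_/=.
  apply: (le_lt_trans (ell2_coord_le (x0 - y) k)).
  by near: y.
have [l Fl] := choice coordP.
have sumP (x0 : ell2 R) (e : R) : (\forall y \near F, `|x0 - y| < e) ->
    forall n, \sum_(0 <= k < n) (x0 k - l k) ^+ 2 <= e ^+ 2.
  move=> Fx0 n.
  have h : (fun y : ell2 R => \sum_(0 <= k < n) (x0 k - y k) ^+ 2) @ F -->
      \sum_(0 <= k < n) (x0 k - l k) ^+ 2.
    elim: n => [|n ih].
      by under eq_fun do rewrite big_nil; rewrite big_nil; exact: cvg_cst.
    under eq_fun do rewrite big_nat_recr//= expr2.
    rewrite big_nat_recr//= expr2; apply: cvgD; first exact: ih.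
    by apply: cvgM; apply: cvgB (Fl n); exact: cvg_cst.
  rewrite -(cvg_lim _ h)//; apply: limr_le.
    by apply/cvg_ex; eexists; exact: h.
  near=> y; apply: (le_trans (ell2_norm_ge (x0 - y) n)).
  have e0 : `|x0 - y| < e by near: y.
  by rewrite ler_pXn2r// ?nnegrE// ltW// (le_lt_trans _ e0).
have [x lx] : exists x : ell2 R, (x : nat -> R) = l.
  have [x0 /sumP hx0] := Fb 1 ltr01.
  have [z zE] := ell2_of hx0.
  exists (x0 - z); apply/funext => k.
  by rewrite -[LHS]/(x0 k - z k) zE subKr.
apply/cvg_ex; exists x; apply/cvgrPdist_lt => e e0.
have [|x0 Fx0] := Fb (e / 2); first by rewrite divr_gt0.
have xx0 : `|x0 - x| <= e / 2.
  apply: ell2_norm_le => [|n]; first by rewrite ltW// divr_gt0.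
  rewrite -[X in X <= _]/(\sum_(0 <= k < n) (x0 k - x k) ^+ 2) lx.
  exact: sumP.
near=> y.
rewrite -(subrKA x0) (splitr e) (le_lt_trans (ler_normD _ _))//.
rewrite ler_ltD//; first by rewrite distrC.
by near: y.
Unshelve. all: by end_near. Qed.

End ell2_complete.

HB.instance Definition _ (R : realType) :=
  Uniform_isComplete.Build (ell2 R) (@ell2_complete R).

Section dictionaries.
Variables (R : realType) (X : completeNormedModType R).
Implicit Types (D : set X) (f : X).

Definition linear_span D : set X :=
  [set x | exists (n : nat) (c : 'I_n -> R) (g : 'I_n -> X),
    (forall i, D (g i)) /\ x = \sum_(i < n) c i *: g i].

Definition is_dictionary D : Prop :=
  [/\ forall g, D g -> `|g| <= 1,
      forall g, D g -> D (- g) &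
      closure (linear_span D) = [set: X]].

Definition A1o D : set X :=
  [set f | exists (c : nat -> R) (g : nat -> X),
    [/\ forall i, D (g i),
        (\sum_(0 <= i <oo) `|c i|%:E <= 1)%E &
        series (fun i => c i *: g i) @ \oo --> f]].

Definition A1 D : set X := closure (A1o D).

(* The infimum is that of a nonempty set of reals as soon as [D] is nonempty,
   which holds for every dictionary of a nonzero space; [inf set0] is 0. *)
Definition sigma (m : nat) f D : R :=
  inf [set r | exists (c : 'I_m -> R) (g : 'I_m -> X),
    (forall i, D (g i)) /\ r = `|f - \sum_(i < m) c i *: g i|].

End dictionaries.

(* Main.v *)
Require Import Defs.
From mathcomp Require Import all_boot all_order all_algebra.
From mathcomp Require Import all_classical all_reals all_analysis.
From mathcomp Require Import ring lra.
Set Implicit Arguments.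
Unset Strict Implicit.
Unset Printing Implicit Defensive.
Import Order.TTheory GRing.Theory Num.Theory.
Import numFieldNormedType.Exports.
Local Open Scope classical_set_scope.
Local Open Scope ring_scope.

(** Let e_0, e_1, ... be the coordinate vectors of ell2. The dictionary [atoms]
    consists of the vectors +/- g_k with g_k = (e_0 + e_{k+1}) / sqrt 2, and the
    element to approximate is [target] = e_0 / sqrt 2. All the g_k share the
    component [target], and their other components are orthogonal to each
    other, so averaging them isolates [target] while the rest decays.

    Upper bound. The residual target - (g_0 + ... + g_{m-1}) / (m+1) has
    m+1 coordinates of equal absolute value 1 / (sqrt 2 (m+1)) and no other, so
    its norm is (2 (m+1))^{-1/2}, the value claimed for the m-term error
    ([target_sub_shrunk_average_norm]). The coefficients of this approximant
    have sum less than 1, so the same computation puts [target] in the closure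
    A_1 ([A1_target]); it also puts e_0, hence every e_k, in the closed span,
    which is therefore the whole space ([atoms_dictionary]).

    Lower bound. Given m dictionary elements with indices in a set K, the vector
    y = e_0 - sum_{k in K} e_{k+1} is orthogonal to all of them. A combination h
    of them thus satisfies <target - h, y> = <target, y> = 1 / sqrt 2, while
    |y|^2 = 1 + |K| is at most m + 1, and the Cauchy-Schwarz inequality gives
    |target - h|^2 >= 1 / (2 (m+1)) ([target_dist_ge]). *)

(** * Closed linear spans *)

Lemma closure_distP (R : realType) (X : normedModType R) (S : set X) (x : X) :
  closure S x <-> forall e : R, 0 < e -> exists2 y, S y & `|x - y| < e.
Proof.
split=> [Sx e e0|Sx B /nbhs_ballP[e /= e0 eB]].
  have [y [Sy xy]] := Sx _ (nbhsx_ballx x e e0).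
  by exists y => //; move: xy; rewrite -ball_normE.
have [y Sy xy] := Sx _ e0.
by exists y; split=> //; apply: eB; rewrite -ball_normE.
Qed.

Lemma closure_idem (R : realType) (X : normedModType R) (S : set X) (x : X) :
  closure (closure S) x -> closure S x.
Proof. by have /closure_id <- := @closed_closure _ S. Qed.

Section closed_span.
Context {R : realType} {X : completeNormedModType R}.
Implicit Types (D : set X) (x y : X).

Lemma linear_span_gen D x : D x -> linear_span D x.
Proof.
move=> Dx; exists 1%N, (fun=> 1), (fun=> x); split=> //.
by rewrite big_ord1 scale1r.
Qed.

Lemma linear_spanD D x y :
  linear_span D x -> linear_span D y -> linear_span D (x + y).
Proof.
move=> [n [c [g [Dg ->]]]] [p [d [h [Dh ->]]]].
exists (n + p)%N.
exists (fun i => match fintype.split i with inl j => c j | inr j => d j end).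
exists (fun i => match fintype.split i with inl j => g j | inr j => h j end).
split=> [i|]; first by case: (fintype.split i).
rewrite big_split_ord /=; congr (_ + _); apply: eq_bigr => i _.
  by rewrite (unsplitK (inl i)).
by rewrite (unsplitK (inr i)).
Qed.

Lemma linear_spanZ D a x : linear_span D x -> linear_span D (a *: x).
Proof.
move=> [n [c [g [Dg ->]]]]; exists n, (fun i => a * c i), g; split=> //.
by rewrite scaler_sumr; apply: eq_bigr => i _; rewrite scalerA.
Qed.

Lemma closed_spanD D x y : closure (linear_span D) x ->
  closure (linear_span D) y -> closure (linear_span D) (x + y).
Proof.
move=> /closure_distP Dx /closure_distP Dy; apply/closure_distP => e e0.
have e20 : 0 < e / 2 by rewrite divr_gt0.
have [x' Dx' xx'] := Dx _ e20; have [y' Dy' yy'] := Dy _ e20.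
exists (x' + y'); first exact: linear_spanD.
rewrite opprD addrACA (splitr e).
by rewrite (le_lt_trans (ler_normD _ _))// ltrD.
Qed.

Lemma closed_spanZ D a x : closure (linear_span D) x ->
  closure (linear_span D) (a *: x).
Proof.
move=> /closure_distP Dx; apply/closure_distP => e e0.
have a0 : 0 < `|a| + 1 by rewrite ltr_wpDl.
have [x' Dx' xx'] := Dx _ (divr_gt0 e0 a0).
exists (a *: x'); first exact: linear_spanZ.
rewrite -scalerBr normrZ; rewrite ltr_pdivlMr// in xx'.
rewrite (le_lt_trans _ xx')// mulrC ler_wpM2l//.
by rewrite lerDl.
Qed.

Lemma closed_span_sum D n (c : 'I_n -> R) (g : 'I_n -> X) : D !=set0 ->
  (forall i, closure (linear_span D) (g i)) ->
  closure (linear_span D) (\sum_(i < n) c i *: g i).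
Proof.
move=> [d Dd] Dg; apply: (big_ind (closure (linear_span D))).
- rewrite -(scale0r d); apply: closed_spanZ; apply: subset_closure.
  exact: linear_span_gen.
- by move=> x y; exact: closed_spanD.
- by move=> i _; exact: closed_spanZ.
Qed.

End closed_span.

(** * Coordinates in ell2 *)

Section ell2_coordinates.
Context {R : realType}.
Implicit Types (x : ell2 R) (y : nat -> R).

Lemma ell2_sumE n (c : 'I_n -> R) (g : 'I_n -> ell2 R) k :
  (\sum_(i < n) c i *: g i) k = \sum_(i < n) c i * g i k.
Proof.
elim: n c g => [|n ih] c g; first by rewrite !big_ord0.
by rewrite !big_ord_recr /= -ih.
Qed.

(** Norm bounds are obtained from a closed form [u] for the squared coordinates,
    so that the partial sums to estimate are sums of explicit reals. *)
Lemma ell2_norm_le_sqr x (u : nat -> R) (M : R) : 0 <= M ->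
  (forall k, x k ^+ 2 = u k) -> (forall n, \sum_(0 <= k < n) u k <= M ^+ 2) ->
  `|x| <= M.
Proof.
move=> M0 xu uM; apply: ell2_norm_le => // n.
by rewrite (eq_bigr u) => [|k _]; [exact: uM|exact: xu].
Qed.

(** The Cauchy-Schwarz inequality against a finitely supported vector, in the
    form |x - t y|^2 >= 0. Keeping the scale [t] free avoids both the division
    by |y|^2 and the inner product of ell2. *)
Lemma ell2_test_le x y (t : R) n :
  2 * t * (\sum_(0 <= k < n) x k * y k) - t ^+ 2 * (\sum_(0 <= k < n) y k ^+ 2)
  <= `|x| ^+ 2.
Proof.
apply: le_trans (ell2_norm_ge x n); rewrite !mulr_sumr -sumrB.
apply: ler_sum => k _; rewrite -subr_ge0.
by rewrite (_ : _ - _ = (x k - t * y k) ^+ 2) ?sqr_ge0//; ring.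
Qed.

Lemma sum_indicator y k n :
  \sum_(0 <= j < n) (j == k)%:R * y j = (k < n)%:R * y k.
Proof.
elim: n => [|n ih]; first by rewrite big_nil mul0r.
rewrite big_nat_recr//= ih ltnS.
by case: (ltngtP k n) => [_|_|->] /=; rewrite ?(mul0r, addr0, add0r).
Qed.

Lemma sum_indicator_sqr_le k n : \sum_(0 <= j < n) ((j == k)%:R : R) ^+ 2 <= 1.
Proof.
under eq_bigr do rewrite expr2.
rewrite (sum_indicator (fun j => (j == k)%:R)) eqxx mulr1.
by case: (k < n)%N.
Qed.

Definition basis k : ell2 R :=
  Lfun_Sub (lee1n 2) (ell2_of_subproof (sum_indicator_sqr_le k)).

Lemma basisE k j : basis k j = (j == k)%:R.
Proof. by []. Qed.

(** The error of the truncation of [x] to its first n coordinates is the tail of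
    the convergent series of squares. *)
Lemma basis_total x (e : R) : 0 < e ->
  exists n, `|x - \sum_(i < n) x i *: basis i| < e.
Proof.
move=> e0; have e20 : 0 < e / 2 by rewrite divr_gt0.
have /cvgrPdist_lt/(_ _ (exprn_gt0 2 e20)) := @ell2_norm_cvg R x.
move=> [n _ /(_ n (leqnn n)) /= /ltW hn]; exists n.
apply: (@le_lt_trans _ _ (e / 2)); last by rewrite ltr_pdivrMr// ltr_pMr// ltr1n.
apply: (@ell2_norm_le_sqr _ (fun j => ((n <= j)%:R * x j) ^+ 2)) => [|j|p].
- exact: ltW.
- rewrite -[X in X ^+ 2]/(x j - (\sum_(i < n) x i *: basis i) j) ell2_sumE.
  have -> : \sum_(i < n) x i * basis i j = (j < n)%:R * x j.
    rewrite -sum_indicator big_mkord; apply: eq_bigr => i _.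
    by rewrite basisE mulrC eq_sym.
  by case: (ltnP j n) => _ /=; ring.
apply: le_trans hn; rewrite /series /= ger0_norm; last first.
  by rewrite subr_ge0 ell2_norm_ge.
(* The tail sum up to p and the first n squares of x together make up a partial
   sum of the squares of x, which is at most `|x|^2. *)
rewrite lerBrDr; apply: le_trans (ell2_norm_ge x (maxn p n)).
rewrite (@big_cat_nat _ _ _ n 0 (maxn p n))//= ?leq_maxr// [leRHS]addrC lerD2r.
have [pn|np] := leqP p n.
  rewrite big_nat big1 ?sumr_ge0// => [i _|j /andP[_ jp]]; first exact: sqr_ge0.
  by rewrite leqNgt (leq_trans jp pn) mul0r expr0n.
rewrite (@big_cat_nat _ _ _ n 0 p)/= ?(ltnW np)//.
rewrite big_nat big1 ?add0r => [|j /andP[_ jn]]; last first.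
  by rewrite leqNgt jn mul0r expr0n.
rewrite le_eqVlt; apply/orP; left; apply/eqP.
by apply: eq_big_nat => j /andP[nj _]; rewrite nj mul1r.
Qed.

End ell2_coordinates.

(** * The extremal dictionary *)

Lemma sum_ltn_le n m : (\sum_(0 <= j < n) (j < m) <= m)%N.
Proof.
have -> : (\sum_(0 <= j < n) (j < m) = minn n m)%N; last exact: geq_minr.
elim: n => [|n ih]; first by rewrite big_nil min0n.
rewrite big_nat_recr//= ih; case: (ltnP n m) => nm /=.
  by rewrite (minn_idPl nm) addn1.
by rewrite addn0 (minn_idPr (leqW nm)).
Qed.

Section extremal_dictionary.
Context {R : realType}.

Definition atom (k : nat) : ell2 R := (Num.sqrt 2)^-1 *: (basis 0 + basis k.+1).

Definition atoms : set (ell2 R) :=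
  [set g | exists k, g = atom k \/ g = - atom k].

Definition target : ell2 R := (Num.sqrt 2)^-1 *: basis 0.

(** The weight is 1/(m+1), not 1/m: it minimizes the distance to [target] among
    the combinations of the first m atoms with equal coefficients, since
    (1 - m t)^2 + m t^2 is least at t = 1/(m+1). *)
Definition shrunk_average m : ell2 R := \sum_(i < m) m.+1%:R^-1 *: atom i.

Definition error m : R := 1 / Num.sqrt 2 * (m.+1%:R `^ (- (1 / 2))).

Lemma sqrt2V_sqr : (Num.sqrt 2)^-1 ^+ 2 = 2^-1 :> R.
Proof. by rewrite exprVn sqr_sqrtr. Qed.

Lemma error_ge0 m : 0 <= error m.
Proof. by rewrite mulr_ge0 ?powR_ge0// divr_ge0 ?sqrtr_ge0. Qed.

Lemma error_sqr m : error m ^+ 2 = (2 * m.+1%:R)^-1.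
Proof.
rewrite /error !div1r powRN powR12_sqrt// exprMn sqrt2V_sqr exprVn sqr_sqrtr//.
by rewrite invfM.
Qed.

Lemma error_cvg0 (e : R) : 0 < e -> exists m, error m < e.
Proof.
move=> e0; have e20 : 0 < e ^+ 2 by rewrite exprn_gt0.
exists (Num.trunc (e ^+ 2)^-1); set m := Num.trunc _.
rewrite -(ltr_pXn2r (n := 2))// ?nnegrE ?error_ge0 ?(ltW e0)// error_sqr.
have mP : (e ^+ 2)^-1 < m.+1%:R := truncnS_gt _.
rewrite -[ltRHS]invrK ltf_pV2 ?posrE ?mulr_gt0 ?invr_gt0//.
by rewrite (lt_le_trans mP)// ler_peMl// ler1n.
Qed.

Lemma atomE k j : atom k j = (Num.sqrt 2)^-1 * ((j == 0%N)%:R + (j == k.+1)%:R).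
Proof. by []. Qed.

Lemma atoms_atom k : atoms (atom k).
Proof. by exists k; left. Qed.

Lemma atom_norm_le1 k : `|atom k| <= 1.
Proof.
apply: (@ell2_norm_le_sqr _ _ (fun j => 2^-1 * (j == 0%N)%:R ^+ 2 +
                                      2^-1 * (j == k.+1)%:R ^+ 2)) => // [j|n].
  rewrite atomE exprMn sqrt2V_sqr -mulrDr.
  by case: j => [|j] /=; congr (_ * _); ring.
rewrite expr1n big_split/= -!mulr_sumr.
have := sum_indicator_sqr_le (R := R) 0 n.
have := sum_indicator_sqr_le (R := R) k.+1 n.
by lra.
Qed.

(** At coordinate 0 the residual is (1 - m/(m+1)) / sqrt 2, at coordinates 1 to m
    it is - 1 / ((m+1) sqrt 2): the squares agree. *)
Lemma target_sub_shrunk_average_sqr m j :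
  (target - shrunk_average m) j ^+ 2 = (j <= m)%N%:R * (2 * m.+1%:R ^+ 2)^-1.
Proof.
rewrite -[(target - shrunk_average m) j]/(target j - shrunk_average m j).
rewrite -[target j]/((Num.sqrt 2)^-1 * (j == 0%N)%:R) ell2_sumE.
have m0 : m.+1%:R != 0 :> R by rewrite pnatr_eq0.
case: j => [|j].
  under eq_bigr do rewrite atomE addr0 mulr1.
  rewrite eqxx mulr1 sumr_const card_ord -[_ *+ m]mulr_natl mul1r invfM.
  rewrite -sqrt2V_sqr.
  rewrite -natr1 in m0 *; field.
  by rewrite m0 sqrtr_eq0 -ltNge ltr0n.
have -> : \sum_(i < m) m.+1%:R^-1 * atom i j.+1 =
    (j < m)%N%:R * ((Num.sqrt 2)^-1 / m.+1%:R) :> R.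
  rewrite -(sum_indicator (fun=> _ : R)) big_mkord.
  apply: eq_bigr => i _; rewrite atomE/= add0r eqSS eq_sym.
  by rewrite mulrA [RHS]mulrC (mulrC m.+1%:R^-1).
rewrite /= mulr0 sub0r sqrrN exprMn exprMn sqrt2V_sqr exprVn -invfM.
by congr (_ * _); case: (j < m)%N; rewrite ?(expr1n, expr0n).
Qed.

Lemma target_sub_shrunk_average_norm m : `|target - shrunk_average m| <= error m.
Proof.
apply: (ell2_norm_le_sqr (error_ge0 m) (target_sub_shrunk_average_sqr m)) => n.
rewrite -mulr_suml -natr_sum error_sqr.
have m0 : 0 < m.+1%:R :> R by rewrite ltr0n.
rewrite ler_pdivrMr ?mulr_gt0 ?exprn_gt0//.
rewrite (_ : _^-1 * _ = m.+1%:R) ?ler_nat ?(sum_ltn_le n m.+1)//.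
by field; rewrite lt0r_neq0.
Qed.

(** The approximants [shrunk_average m] are themselves in A1o, as their
    coefficients have sum m/(m+1). *)
Lemma A1_target : A1 atoms target.
Proof.
apply/closure_distP => e /error_cvg0[m em].
exists (shrunk_average m); last exact: le_lt_trans (target_sub_shrunk_average_norm m) em.
pose c i : R := (i < m)%N%:R / m.+1%:R.
exists c, atom; split=> [i||]; first exact: atoms_atom.
  apply: lime_le; first exact: is_cvg_nneseries.
  apply: nearW => n; rewrite sumEFin lee_fin.
  rewrite (eq_bigr (fun i => (i < m)%N%:R / m.+1%:R)); last first.
    by move=> i _; rewrite ger0_norm// divr_ge0.
  rewrite -mulr_suml -natr_sum ler_pdivrMr ?ltr0n// mul1r ler_nat.
  by apply: leq_trans (leqnSn m); exact: sum_ltn_le.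
apply: cvg_near_cst; exists m => // n /= mn.
rewrite /series /= (big_cat_nat _ mn)//= [X in _ + X]big_nat.
rewrite [X in _ + X]big1 => [|i].
  rewrite addr0 big_mkord; apply: eq_bigr => i _.
  by rewrite /c ltn_ord mul1r.
by move=> /andP[mi _]; rewrite /c ltnNge mi mul0r scale0r.
Qed.

(** Completeness: e_0 is sqrt 2 times the limit of the [shrunk_average m], then
    e_{k+1} = sqrt 2 g_k - e_0, and the coordinate vectors span a dense
    subspace. *)
Lemma atoms_dictionary : is_dictionary atoms.
Proof.
have gen k : closure (linear_span atoms) (atom k).
  by apply: subset_closure; apply: linear_span_gen; exact: atoms_atom.
have atoms0 : atoms !=set0 by exists (atom 0); exact: atoms_atom.
have sqrt2 : Num.sqrt 2 != 0 :> R by rewrite sqrtr_eq0 -ltNge ltr0n.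
split=> [g [k [->|->]]|g [k [->|->]]|].
- exact: atom_norm_le1.
- by rewrite normrN atom_norm_le1.
- by exists k; right.
- by exists k; left; rewrite opprK.
have span0 : closure (linear_span atoms) (basis 0).
  rewrite (_ : basis 0 = Num.sqrt 2 *: target); last first.
    by rewrite scalerA divff// scale1r.
  apply: closed_spanZ; apply: closure_idem; apply/closure_distP => e.
  move=> /error_cvg0[m em]; exists (shrunk_average m).
    by apply: closed_span_sum => // i; exact: gen.
  exact: le_lt_trans (target_sub_shrunk_average_norm m) em.
have span_basis k : closure (linear_span atoms) (basis k).
  case: k => [//|k].
  rewrite (_ : basis k.+1 = Num.sqrt 2 *: atom k + (- 1) *: basis 0).
    by apply: closed_spanD; apply: closed_spanZ.
  by rewrite scalerA divff// scale1r scaleN1r addrAC subrr add0r.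
apply/seteqP; split=> // x _.
apply: closure_idem; apply/closure_distP => e /(basis_total x)[n xn].
exists (\sum_(i < n) x i *: basis i) => //.
by apply: closed_span_sum => // i; exact: span_basis.
Qed.

(** Duality: whatever the m atoms are, some vector [y] with squared norm at most
    m+1 annihilates all of them but has inner product 1 / sqrt 2 with
    [target]. *)
Lemma target_dist_ge m (c : 'I_m -> R) (g : 'I_m -> ell2 R) :
  (forall i, atoms (g i)) -> error m <= `|target - \sum_(i < m) c i *: g i|.
Proof.
move=> /choice[k gk].
pose used j := [exists i, k i == j].
pose y j : R := if j is j'.+1 then - (used j')%:R else 1.
(* All the inner products with y can be cut at N, past the support of every
   atom in use. *)
pose N := (\max_(i < m) k i).+2.
have kN i : ((k i).+1 < N)%N by rewrite !ltnS leq_bigmax.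
have y_atom i : \sum_(0 <= j < N) g i j * y j = 0.
  have : \sum_(0 <= j < N) atom (k i) j * y j = 0.
    under eq_bigr do rewrite atomE -mulrA mulrDl.
    rewrite -mulr_sumr big_split/= !sum_indicator kN !mul1r /=.
    rewrite (_ : used (k i)) ?subrr ?mulr0//.
    by apply/existsP; exists i.
  case: (gk i) => -> // h; rewrite -[RHS]oppr0 -[in RHS]h -sumrN.
  by apply: eq_bigr => j _; rewrite -mulNr.
have y_target : \sum_(0 <= j < N) target j * y j = (Num.sqrt 2)^-1.
  rewrite (eq_bigr (fun j => (Num.sqrt 2)^-1 * ((j == 0%N)%:R * y j))).
    by rewrite -mulr_sumr sum_indicator !mulr1.
  by move=> j _; rewrite mulrA.
set h := \sum_(i < m) _.
have y_residual : \sum_(0 <= j < N) (target - h) j * y j = (Num.sqrt 2)^-1.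
  transitivity (\sum_(0 <= j < N) (target j * y j - h j * y j)).
    by apply: eq_bigr => j _; rewrite -mulrBl.
  rewrite sumrB y_target (_ : \sum_(_ <= _ < _) h _ * _ = 0) ?subr0//.
  under eq_bigr do rewrite ell2_sumE mulr_suml.
  rewrite exchange_big/= big1// => i _.
  by under eq_bigr do rewrite -mulrA; rewrite -mulr_sumr y_atom mulr0.
have y_norm : \sum_(0 <= j < N) y j ^+ 2 <= m.+1%:R.
  (* Repeated indices can make the set of used indices smaller than m; its
     indicator is bounded by the sum over i of the indicators of k i. *)
  rewrite big_nat_recl//= expr1n -nat1r lerD2l.
  apply: (@le_trans _ _ (\sum_(0 <= j < N.-1) \sum_(i < m) (j == k i)%:R ^+ 2)).
    apply: ler_sum => j _; rewrite sqrrN /used.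
    have [/existsP[i /eqP <-]|_] := boolP [exists i, k i == j].
      by rewrite (bigD1 i)//= eqxx lerDl sumr_ge0// => *; exact: sqr_ge0.
    by rewrite expr0n sumr_ge0// => *; exact: sqr_ge0.
  rewrite exchange_big/= -[leRHS]mulr1 mulr_natl -[X in _ *+ X]card_ord.
  by rewrite -sumr_const; apply: ler_sum => i _; exact: sum_indicator_sqr_le.
have m0 : 0 < m.+1%:R :> R by rewrite ltr0n.
rewrite -(ler_pXn2r (n := 2))// ?nnegrE ?error_ge0// error_sqr.
(* t is the value 1/sqrt 2 of the inner product divided by the bound m+1 on the
   squared norm of y, the maximizer of 2 t / sqrt 2 - t^2 (m+1). *)
pose t : R := (Num.sqrt 2)^-1 / m.+1%:R.
apply: le_trans (ell2_test_le (target - h) y t N); rewrite y_residual.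
have t2 : t ^+ 2 = (2 * m.+1%:R ^+ 2)^-1.
  by rewrite exprMn sqrt2V_sqr exprVn -invfM.
have le_t2 := ler_wpM2l (sqr_ge0 t) y_norm.
apply: le_trans (lerB (lexx _) le_t2).
rewrite t2 -mulrA mulrAC -expr2 sqrt2V_sqr.
rewrite le_eqVlt; apply/orP; left; apply/eqP.
by field; rewrite lt0r_neq0.
Qed.

Lemma sigma_target m : sigma m target atoms = error m.
Proof.
rewrite /sigma; set S := (X in inf X).
have lbS : lbound S (error m) by move=> _ [c [g [Dg ->]]]; exact: target_dist_ge.
have avgS : S `|target - shrunk_average m|.
  exists (fun=> m.+1%:R^-1), (fun i => atom i); split=> // i.
  exact: atoms_atom.
apply/eqP; rewrite eq_le; apply/andP; split.
  apply: le_trans (target_sub_shrunk_average_norm m).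
  by apply: ge_inf => //; exists (error m).
by apply: lb_le_inf => //; exists `|target - shrunk_average m|.
Qed.

End extremal_dictionary.

Theorem theorem3p1 (R : realType) :
  exists (D : set (ell2 R)) (f : ell2 R),
    [/\ is_dictionary D,
        A1 D f &
        forall m : nat, (0 < m)%N ->
          sigma m f D = 1 / Num.sqrt 2 * (m.+1%:R `^ (- (1 / 2)))].
Proof.
exists atoms, target; split=> [||m _].
- exact: atoms_dictionary.
- exact: A1_target.
- exact: sigma_target.
Qed.
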